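(* Let $n\ge 2$, $2\le b\le n$, and let $r_2,\dots,r_b\ge 0$ be integers such that $m:=2r_2+3r_3+\cdots+b r_b\le n$. Then $$\mathbb{E}\left(\tilde C_2(n)^{[r_2]}\cdots \tilde C_b(n)^{[r_b]}\right)=\tilde\lambda_2^{r_2}\cdots\tilde\lambda_b^{r_b}\; e^{m}\, n_{[m]}\,\frac{(n-m-1)^{n-m}}{(n-1)^n},$$ where $\tilde\lambda_j=\frac1j\,\mathbb{P}(\mathrm{Po}(j)<j-1)$ for $j\ge2$.
   Context: Write $[n]=\{1,\dots,n\}$. For $n\ge 2$, the screaming toes mapping of size $n$ is the random mapping $f:[n]\to[n]$, $f(i)=B_i$, where $B_1,\dots,B_n$ are independent and $\mathbb{P}(B_i=j)=1/(n-1)$ for $j\in[n]\setminus\{i\}$; equivalently, $f$ is uniform over the $(n-1)^n$ mappings with no fixed points. Two elements $i,j$ are in the same component of a mapping if some iterate of $i$ equals some iterate of $j$ (iterates $f^k$, $k\ge 0$); the size of a component is its number of elements. $\tilde C_j(n)$ is the number of components of size $j$. Falling factorials: $x^{[r]}=x_{[r]}=x(x-1)\cdots(x-r+1)$, with $x^{[0]}=x_{[0]}=1$. The convention $y^0=1$ is used for every real $y$ (relevant when $m=n$). $\mathrm{Po}(\mu)$ denotes a Poisson random variable with mean $\mu$. *)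

(* Defs.v *)
From HB Require Import structures.
From mathcomp Require Import all_boot all_order all_algebra.
From mathcomp Require Import all_classical all_reals all_analysis.
Set Implicit Arguments.
Unset Strict Implicit.
Unset Printing Implicit Defensive.
Import Order.TTheory GRing.Theory Num.Theory.
Import numFieldNormedType.Exports.
Local Open Scope ring_scope.

Section Components.
Context {V : finType}.
Implicit Types (f : V -> V) (x y : V).

Definition same_component f x y : Prop :=
  exists k l : nat, iter k f x = iter l f y.

Definition component f x : {set V} := [set y | `[< same_component f x y >]]%SET.

Definition components f : {set {set V}} := [set component f x | x : V]%SET.

Definition num_components f (j : nat) : nat :=
  #|[set A in components f | #|A| == j]%SET|.

End Components.

Local Open Scope classical_set_scope.

Section ScreamingToes.
Context {R : realType} {d : measure_display} {T : measurableType d}.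
Variable P : probability T R.

(* The product rule over every subfamily J of the finite index type I.  A
   random variable with values in the finite type V is a function whose fibres
   are measurable, so that every A i : set V gives an event. *)
Definition mutually_independent {I V : finType} (X : I -> T -> V) : Prop :=
  forall (J : {set I}) (A : I -> set V),
    P (\bigcap_(i in [set` J]) (X i @^-1` A i)) =
    (\prod_(i in J) P (X i @^-1` A i))%E.

(* The random mapping is i |-> B i t at the sample point t; 'I_n, that is
   {0, ..., n-1}, stands for [n].  For n >= 2, P(B i = i) = 0 follows from
   the law below, whose other n - 1 atoms have total mass 1. *)
Record screaming_toes (n : nat) (B : 'I_n -> T -> 'I_n) : Prop := {
  toes_measurable : forall i j, measurable (B i @^-1` [set j]) ;
  toes_law : forall i j, j != i ->
    P (B i @^-1` [set j]) = ((n%:R - 1)^-1)%:E ;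
  toes_independent : mutually_independent B
}.

End ScreamingToes.

(* For j >= 2, so that j.-1 is j - 1 and the rate is positive.  The second
   argument of poisson_prob is a dummy on which its value does not depend. *)
Definition toes_lambda (R : realType) (j : nat) : R :=
  j%:R^-1 * fine (poisson_prob (j%:R : R) 0 [set k | (k < j.-1)%N]).

(* Main.v *)
Require Import Defs.
From mathcomp Require Import all_boot all_order all_algebra.
From mathcomp Require Import all_classical all_reals all_analysis.
From mathcomp Require Import measurable_realfun ring zify.
Set Implicit Arguments.
Unset Strict Implicit.
Unset Printing Implicit Defensive.
Import Order.TTheory GRing.Theory Num.Theory.
Import numFieldNormedType.Exports.
Local Open Scope ring_scope.

(** The moment is [(n-1)^-n] times the number of fixed-point-free maps weighted
    by the ordered choices of distinct components of the prescribed sizes.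
    Cutting a component [A] out of a map of [S] leaves a connected map of [A]
    and an arbitrary map of [S :\: A], so by induction on the number of chosen
    components the count is [n_[m] (n-m-1)^(n-m)] times a factor [c_j / j!] for
    each chosen component of size [j], where [c_j] counts the connected maps of
    a [j]-set.  The same cut, applied to the component of a given point,
    gives a recursion that determines [c_j]; its solution
    [c_j = (j-1)! * sum_(k < j-1) j^k / k!], which is [j! e^j toes_lambda j], is
    confirmed by an identity of Abel type. *)

(** * Finite differences and a sum of Abel type *)

(** An [M]-th difference annihilates degrees below [M]. The induction on [d] lowers [M] along with
    it and moves [x] to [x + 1], so both are kept general. *)
Lemma finite_difference_exp (R : comNzRingType) (M d : nat) (x : R) :
  (d <= M)%N ->
  \sum_(l < M.+1) ((-1) ^+ (M - l) * (x + l%:R) ^+ d) *+ 'C(M, l) =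
  M`!%:R *+ (d == M).
Proof.
elim: d M x => [|d IH] [|M] x //= leM.
- by rewrite big_ord1 /= subnn mul1r.
- have := exprDn (-1 : R) 1 M.+1; rewrite addNr expr0n /= => /esym e.
  rewrite -[RHS]e; apply: eq_bigr => l _; by rewrite expr1n.
(* One factor [x + l] is split off the power. The [x] part has degree [d < M.+1] and vanishes; in
   the [l] part, [l * 'C(M.+1, l) = M.+1 * 'C(M, l.-1)] leaves an [M]-th difference at [x + 1]. *)
rewrite (eq_bigr (fun l : 'I_M.+2 =>
   x * (((-1) ^+ (M.+1 - l) * (x + l%:R) ^+ d) *+ 'C(M.+1, l)) +
   ((-1) ^+ (M.+1 - l) * (x + l%:R) ^+ d) *+ (l * 'C(M.+1, l)))); last first.
  move=> l _; rewrite exprS mulrnA; ring.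
rewrite big_split -mulr_sumr /= IH; last exact: leqW.
rewrite ltn_eqF // mulr0 add0r big_ord_recl /= mul0n mulr0n add0r.
rewrite (eq_bigr (fun l : 'I_M.+1 =>
   (((-1) ^+ (M - l) * ((x + 1) + l%:R) ^+ d) *+ 'C(M, l)) *+ M.+1)); last first.
  move=> l _; rewrite /bump /= add1n subSS -mul_bin_diag /= -mulrnA mulnC.
  by rewrite -addrA -natr1 [1 + _]addrC.
rewrite sumrMnl IH // factS eqSS -mulrnA mulnC mulrnA.
by rewrite -!mulrnA; congr (_ *+ _); case: eqP => _; rewrite ?muln0 ?muln1 ?mul0n ?mul1n 1?mulnC.
Qed.

(** Both sides are the trinomial coefficient N! / (l! k! (N - l - k)!), or zero when [l + k > N]. *)
Lemma bin_mul_bin_sub (N l k : nat) :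
  ('C(N, l) * 'C(N - l, k) = 'C(N, k) * 'C(N - k, l))%N.
Proof.
have [le|lt] := leqP (l + k) N; last first.
  have [lk|kl] := leqP l N; last first.
    by rewrite (@bin_small N l) // (@bin_small (N - k) l) ?muln0 //; lia.
  have [kN|Nk] := leqP k N; last first.
    by rewrite (@bin_small (N - l) k) ?(@bin_small N k) ?muln0 //; lia.
  by rewrite (@bin_small (N - l)) ?(@bin_small (N - k)) ?muln0 //; lia.
have h a c : (a + c <= N)%N -> ('C(N, a) * 'C(N - a, c) * (a`! * c`! * (N - a - c)`!) = N`!)%N.
  move=> ac; have e1 := @bin_fact N a ltac:(lia); have e2 := @bin_fact (N - a) c ltac:(lia).
  rewrite -e1 -e2; ring.
have e1 := h l k le; have := h k l ltac:(lia).
rewrite -e1 -!subnDA [(k + l)%N]addnC [(k`! * l`!)%N]mulnC => /eqP.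
by rewrite eqn_pmul2r ?muln_gt0 ?fact_gt0 // => /eqP.
Qed.

(* Expanding [y + (N - l) = (x + y + N) - (x + l)] makes the sum over [l] a
   finite difference. *)
Lemma abel_sum (R : comNzRingType) (N : nat) (x y : R) :
  \sum_(l < N.+1)
     ((x + l%:R) ^+ l * (y + (N - l)%:R) ^+ (N - l)) *+ 'C(N, l) =
  \sum_(k < N.+1) (x + y + N%:R) ^+ (N - k) *+ (N ^_ k).
Proof.
set z := x + y + N%:R.
have -> : \sum_(l < N.+1)
     ((x + l%:R) ^+ l * (y + (N - l)%:R) ^+ (N - l)) *+ 'C(N, l) =
  \sum_(l < N.+1) \sum_(k < N.+1)
     ((-1) ^+ (N - k - l) * (x + l%:R) ^+ (N - k)) *+ 'C(N - k, l) * (z ^+ k *+ 'C(N, k)).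
  apply: eq_bigr => l _.
  have -> : y + (N - l)%:R = - (x + l%:R) + z.
    by rewrite /z natrB; [ring | rewrite -ltnS].
  have leN : (N - l < N.+1)%N by rewrite ltnS leq_subr.
  (* The binomial coefficient vanishes beyond [N - l], so the inner sum can run to [N] for every [l]
     and the two sums can be exchanged. *)
  rewrite [X in _ * X]exprDn (@big_ord_widen _ _ _ (N - l).+1 N.+1 (fun k => (- (x + l%:R)) ^+ (N - l - k) * z ^+ k *+ 'C(N - l, k))) //.
  rewrite big_distrr -sumrMnl /= big_mkcond; apply: eq_bigr => k _.
  transitivity (((-1) ^+ (N - l - k) * (x + l%:R) ^+ (N - k) * z ^+ k)
                  *+ ('C(N, l) * 'C(N - l, k))); last first.
    by rewrite bin_mul_bin_sub subnAC; ring.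
  case: ltnP => kl; last by rewrite (bin_small kl) muln0 mulr0n.
  have -> : (N - k = l + (N - l - k))%N by have := ltn_ord l; lia.
  by rewrite (exprNn (x + l%:R)) exprD; ring.
(* Reversing [k] turns the inner sum into the [k]-th difference of a power of degree [k], which is
   k!; times ['C(N, N - k)] this is [N ^_ k]. *)
rewrite exchange_big /= (reindex_inj rev_ord_inj) /=; apply: eq_bigr => k _.
rewrite subSS -mulr_suml.
have kN : (k <= N)%N by rewrite -ltnS.
rewrite subKn //.
have lt : (k < N.+1)%N by [].
pose F l := ((-1) ^+ (k - l) * (x + l%:R) ^+ k) *+ 'C(k, l) : R.
have -> : \sum_(l < N.+1) F l = \sum_(l < k.+1) F l.
  rewrite (@big_ord_widen _ _ _ k.+1 N.+1 F) // [RHS]big_mkcond; apply: eq_bigr => l _.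
  case: ltnP => // kl; by rewrite /F bin_small.
rewrite /F finite_difference_exp // eqxx mulr1n bin_sub // -bin_ffact.
by rewrite mulr_natl -mulrnA.
Qed.

(** * The recursion for the connected counts *)

Lemma ffactD (n a c : nat) : (n ^_ (a + c) = n ^_ a * (n - a) ^_ c)%N.
Proof.
elim: a n => [|a IH] n; first by rewrite mul1n subn0.
case: n => [|n]; first by rewrite addSn !ffact0n.
by rewrite addSn !ffactSS IH mulnA subSS.
Qed.

(** The term [t] is the number of connected maps of a [j]-set whose cycle has [t + 1] points;
    [t = 0] would be a fixed point. *)
Definition connected_count (j : nat) : nat :=
  (\sum_(1 <= t < j) j.-1 ^_ t * j ^ (j.-1 - t))%N.

(** Since [s = M - (M - s)], the term at [s] is [M ^_ s * M ^ (M - s).+1] minus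
    [M ^_ s.+1 * M ^ (M - s)]; the last remainder contains [M ^_ M.+1 = 0]. *)
Lemma sum_ffact_telescope (M : nat) :
  (\sum_(1 <= s < M.+1) s * (M ^_ s * M ^ (M - s)) = M ^ M.+1)%N.
Proof.
have h k : (k <= M)%N -> (\sum_(1 <= s < k.+1) s * (M ^_ s * M ^ (M - s)) +
   M ^_ k.+1 * M ^ (M - k) = M ^ M.+1)%N.
  elim: k => [|k IH] kM.
    by rewrite big_nil add0n ffactn1 subn0 expnS.
  rewrite big_nat_recr // -IH; last exact: ltnW.
  rewrite -addnA; congr addn.
  rewrite (ffactnSr _ k.+1) (_ : M - k = (M - k.+1).+1)%N ?expnS; last by lia.
  have eM : (k.+1 + (M - k.+1) = M)%N by rewrite subnKC.
  rewrite -[X in (_ = _ * (X * _))%N]eM. ring.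
by rewrite -[RHS](h M) // ffact_small // mul0n addn0.
Qed.

(* The recursion obtained by classifying the fixed-point-free maps of [M + 1]
   points by the component of a given point. *)
Lemma connected_count_rec (M : nat) :
  (\sum_(p < M.+1) 'C(M, p) * connected_count p.+1 * (M - p).-1 ^ (M - p)
   = M ^ M.+1)%N.
Proof.
apply/eqP; rewrite -(eqr_nat int); apply/eqP; rewrite natr_sum.
(* For [p = M] the truncated predecessor differs from [-1 + 0], but both carry the exponent 0. *)
have pe p : (p <= M)%N -> ((M - p).-1 ^ (M - p))%:R = (-1 + (M - p)%:R) ^+ (M - p) :> int.
  move=> pM; case: (M - p)%N => [|q] //; rewrite natrX -natr1; congr (_ ^+ _); ring.
(* This uses ['C(M, p) * p ^_ t = M ^_ t * 'C(M - t, p - t)]: for fixed [t] the sum over [p] becomes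
   an Abel sum with [N = M - t], [x = t + 1], [y = -1], so that [x + y + N = M]. *)
pose G t p : int := (M ^_ t * 'C(M - t, p - t))%:R *
   ((p.+1)%:R ^+ (p - t) * (-1 + (M - p)%:R) ^+ (M - p)).
transitivity (\sum_(0 <= p < M.+1) \sum_(1 <= t < M.+1 | (t <= p)%N) G t p).
  rewrite big_mkord; apply: eq_bigr => p _.
  have pM : (p <= M)%N by rewrite -ltnS.
  rewrite !natrM pe // /connected_count natr_sum mulr_sumr mulr_suml.
  rewrite (@big_nat_widen _ _ _ 1 p.+1 M.+1) ?ltnS // big_nat_cond [RHS]big_nat_cond.
  apply: eq_big => [t|t /andP[_]]; first by rewrite ltnS.
  rewrite ltnS => tp.
  rewrite /G /= mulrA; congr (_ * _).
  rewrite -natrX -!natrM; congr (_%:R); rewrite mulnA; congr muln.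
  have : ('C(M, p) * 'C(p, t) * t`! = 'C(M, t) * 'C(M - t, p - t) * t`!)%N.
    congr muln; have e1 := bin_fact pM; have e2 := bin_fact tp.
    have e3 := bin_fact (leq_trans tp pM).
    have e4 := bin_fact (leq_sub2r t pM).
    apply/eqP; rewrite -(@eqn_pmul2r (t`! * (p - t)`! * (M - p)`!)) ?muln_gt0 ?fact_gt0 //; apply/eqP.
    transitivity (M`!); first by rewrite -e1 -e2; ring.
    by rewrite -e3 -e4 (_ : M - t - (p - t) = M - p)%N; [ring | lia].
  by rewrite -!bin_ffact => e; rewrite mulnA e mulnAC.
rewrite (exchange_big_dep_nat xpredT) //=.
(* With [s = t + k], the Abel sum contributes [M ^_ s * M ^ (M - s)] for each [s] from [t] to [M].
   Every [s] then occurs for [t = 1, ..., s], which supplies the factor [s] of the telescoping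
   sum. *)
rewrite -sum_ffact_telescope natr_sum.
transitivity (\sum_(1 <= t < M.+1) \sum_(1 <= s < M.+1 | (t <= s)%N)
   (M ^_ s * M ^ (M - s))%:R : int).
  rewrite big_nat_cond [RHS]big_nat_cond; apply: eq_bigr => t /andP[/andP[t1 tM] _].
  rewrite ltnS in tM.
  rewrite -(@big_nat_widenl _ _ _ t 0 M.+1 xpredT) // -(@big_nat_widenl _ _ _ t 1 M.+1 xpredT) //.
  rewrite -[X in \sum_(X <= _ < _) _ = _]add0n -[X in _ = \sum_(X <= _ < _) _]add0n !big_addn !big_mkord subSn //.
  set N := (M - t)%N.
  transitivity ((M ^_ t)%:R * \sum_(l < N.+1)
     (((t.+1)%:R + l%:R) ^+ l * (-1 + (N - l)%:R) ^+ (N - l)) *+ 'C(N, l) : int).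
    rewrite mulr_sumr; apply: eq_bigr => l _; rewrite /G addnK.
    have -> : (M - (l + t) = N - l)%N by rewrite /N; lia.
    have -> : (l + t).+1%:R = (t.+1)%:R + l%:R :> int by rewrite -natrD; congr (_%:R); lia.
    by rewrite natrM -/N; ring.
  rewrite abel_sum mulr_sumr; apply: eq_bigr => k _.
  have -> : (t.+1)%:R + -1 + N%:R = M%:R :> int.
    rewrite -natr1 addrK -natrD /N subnKC //.
  rewrite [(k + t)%N]addnC ffactD -/N.
  have -> : (M - (t + k) = N - k)%N by rewrite /N; lia.
  rewrite !natrM natrX; ring.
rewrite (exchange_big_dep_nat xpredT) //=.
rewrite big_nat_cond [RHS]big_nat_cond; apply: eq_bigr => s /andP[/andP[s1 sM] _].
rewrite -(@big_nat_widen _ _ _ 1 s.+1 M.+1 xpredT) // sumr_const_nat subn1 /=.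
by rewrite -mulrnA (mulnC s).
Qed.

Local Open Scope nat_scope.

(** * Components, and fixed-point-free maps of a subset *)

Section Maps.
Context {V : finType}.
Implicit Types (f g h : {ffun V -> V}) (A S D : {set V}) (x y : V).

Lemma same_component_refl (f : V -> V) x : same_component f x x.
Proof. by exists 0, 0. Qed.

Lemma same_component_sym (f : V -> V) x y :
  same_component f x y -> same_component f y x.
Proof. by move=> [k [l e]]; exists l, k. Qed.

Lemma same_component_trans (f : V -> V) x y z :
  same_component f x y -> same_component f y z -> same_component f x z.
Proof.
move=> [k [l e1]] [k' [l' e2]]; exists (k' + k), (l + l').
by rewrite iterD e1 -iterD addnC iterD e2 -iterD.
Qed.

Lemma in_component (f : V -> V) x y :
  reflect (same_component f x y) (y \in component f x).
Proof. by rewrite inE; exact: asboolP. Qed.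

Lemma component_refl (f : V -> V) x : x \in component f x.
Proof. exact/in_component/same_component_refl. Qed.

Lemma component_eq (f : V -> V) x y :
  y \in component f x -> component f y = component f x.
Proof.
move=> /in_component xy; apply/setP => z.
apply/in_component/in_component; first exact: same_component_trans.
exact/same_component_trans/same_component_sym.
Qed.

Lemma component_step (f : V -> V) x : component f (f x) = component f x.
Proof. by apply: component_eq; apply/in_component; exists 1, 0. Qed.

Lemma componentsP (f : V -> V) D x :
  D \in components f -> x \in D -> component f x = D.
Proof. by move=> /imsetP[y _ ->] /component_eq. Qed.

Lemma component_components (f : V -> V) x : component f x \in components f.
Proof. exact: imset_f. Qed.

Lemma components_neq0 (f : V -> V) D : D \in components f -> exists x, x \in D.
Proof. by move=> /imsetP[x _ ->]; exists x; exact: component_refl. Qed.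

Lemma components_stable (f : V -> V) D x :
  D \in components f -> (f x \in D) = (x \in D).
Proof.
move=> Df; apply/idP/idP => [fx|xD].
  by rewrite -(componentsP Df fx) component_step component_refl.
by rewrite -(componentsP Df xD) -component_step component_refl.
Qed.

(** Following [inv] backwards, an orbit that reaches [x] must start there. *)
Lemma component_fixed (f : V -> V) x :
  (forall y, f y = x -> y = x) -> f x = x -> component f x = [set x]%SET.
Proof.
move=> inv fx; have fix_iter k : iter k f x = x.
  by elim: k => //= k ->.
apply/setP => y; rewrite inE; apply/in_component/eqP => [[k [l]]|->]; last first.
  exact: same_component_refl.
rewrite fix_iter => /esym; elim: l y => //= l IH y /inv; exact: IH.
Qed.

(** Membership in [A] is preserved in both directions, so an orbit meeting that of [x] stays in [A],
    where [f] and [g] have the same iterates. *)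
Lemma component_local (f g : V -> V) A x :
  (forall y, (f y \in A) = (y \in A)) -> (forall y, (g y \in A) = (y \in A)) ->
  {in A, f =1 g} -> x \in A -> component f x = component g x.
Proof.
move=> fA gA fg xA.
have st (k : V -> V) (kA : forall y, (k y \in A) = (y \in A)) i y : (iter i k y \in A) = (y \in A).
  by elim: i => //= i <-.
have it i y : y \in A -> iter i f y = iter i g y.
  by move=> yA; elim: i => //= i <-; rewrite fg // st.
apply/setP => y; apply/in_component/in_component => -[k [l e]]; exists k, l.
  by rewrite -!it // -(st _ fA l) -e st.
by rewrite !it // -(st _ gA l) -e st.
Qed.

(* The fixed-point-free self-maps of [S], extended by the identity: outside
   [S] this only creates components of size 1. *)
Definition toes_maps S : {set {ffun V -> V}} :=
  [set f : {ffun V -> V} | [forall x, if x \in S then f x \in S :\ x else f x == x]]%SET.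

Definition connected_toes_maps S : {set {ffun V -> V}} :=
  [set f in toes_maps S | S \in components f]%SET.

Lemma toes_mapsP S f :
  reflect (forall x, if x \in S then f x \in (S :\ x)%SET else f x == x)
          (f \in toes_maps S).
Proof. by rewrite inE; exact: forallP. Qed.

Lemma toes_maps_in S f x : f \in toes_maps S -> x \in S -> f x \in (S :\ x)%SET.
Proof. by move=> /toes_mapsP/(_ x); case: ifP. Qed.

Lemma toes_maps_out S f x : f \in toes_maps S -> x \notin S -> f x = x.
Proof. by move=> /toes_mapsP/(_ x); case: ifP => // _ /eqP. Qed.

Lemma toes_maps_stable S f x : f \in toes_maps S -> (f x \in S) = (x \in S).
Proof.
move=> fS; have [xS|xS] := boolP (x \in S).
  by have := toes_maps_in fS xS; rewrite inE => /andP[].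
by rewrite (toes_maps_out fS xS) (negbTE xS).
Qed.

(** The values are independent choices. The empty set gives [0 ^ 0 = 1], the identity, and a
    singleton gives [0 ^ 1 = 0]. *)
Lemma card_toes_maps S : #|toes_maps S| = #|S|.-1 ^ #|S|.
Proof.
pose F x : {set V} := if x \in S then (S :\ x)%SET else [set x]%SET.
have -> : #|toes_maps S| = #|family F|.
  apply: eq_card => f; apply/toes_mapsP/familyP => h x; have := h x; rewrite /F;
  by case: ifP; rewrite ?inE.
rewrite card_family foldrE big_map big_enum /=.
rewrite (bigID (mem S)) /= [X in _ * X]big1 ?muln1; last first.
  by move=> x /negbTE xS; rewrite /F xS cards1.
rewrite -prod_nat_const; apply: eq_bigr => x xS.
by rewrite /F xS; have := cardsD1 x S; rewrite xS => ->.
Qed.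

Lemma toes_maps_component_out S f x :
  f \in toes_maps S -> x \notin S -> component f x = [set x]%SET.
Proof.
move=> fS xS; apply: component_fixed; last exact: toes_maps_out fS xS.
move=> y fy; rewrite -fy (toes_maps_out fS) //.
by rewrite -(toes_maps_stable y fS) fy.
Qed.

Lemma toes_maps_component_sub S f D :
  f \in toes_maps S -> D \in components f -> 1 < #|D| -> D \subset S.
Proof.
move=> fS Df D1; apply/fintype.subsetP => x xD; apply: contraLR D1 => xS.
by rewrite -(componentsP Df xD) (toes_maps_component_out fS xS) cards1.
Qed.

(** * Cutting out and gluing in a component *)

(** It also serves for cutting: [glue A f id_ffun] restricts [f] to [A], and [glue A id_ffun f]
    removes [A] from [f]. *)
Definition glue A g h : {ffun V -> V} := [ffun x => if x \in A then g x else h x].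

Definition id_ffun : {ffun V -> V} := [ffun x => x].

Section Glue.
Variables (S A : {set V}) (g h : {ffun V -> V}).
Hypotheses (AS : A \subset S) (gA : g \in toes_maps A)
  (hSA : h \in toes_maps (S :\: A)%SET).

Lemma glue_rest_stable x : (h x \in A) = (x \in A).
Proof.
have [xA|xA] := boolP (x \in A).
  by rewrite (toes_maps_out hSA) // !inE xA.
apply/negbTE; have [xS|xS] := boolP (x \in S); last first.
  by rewrite (toes_maps_out hSA) // !inE (negbTE xS) andbF.
by have := @toes_maps_in _ _ x hSA; rewrite !inE xA xS => /(_ isT) /and3P[].
Qed.

Lemma glue_stable x : (glue A g h x \in A) = (x \in A).
Proof.
rewrite ffunE; have [xA|xA] := boolP (x \in A); first by rewrite (toes_maps_stable _ gA).
by rewrite glue_rest_stable (negbTE xA).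
Qed.

Lemma glue_component x :
  component (glue A g h) x = if x \in A then component g x else component h x.
Proof.
case: ifPn => xA.
  apply: (@component_local _ _ A) => //; first exact: glue_stable.
    by move=> y; rewrite (toes_maps_stable _ gA).
  by move=> y yA; rewrite ffunE yA.
apply: (@component_local _ _ (~: A)%SET); rewrite ?inE //.
- by move=> y; rewrite !inE glue_stable.
- by move=> y; rewrite !inE glue_rest_stable.
by move=> y; rewrite inE ffunE => /negbTE ->.
Qed.

Lemma glue_toes_maps : glue A g h \in toes_maps S.
Proof.
apply/toes_mapsP => x; rewrite ffunE.
have [xA|xA] := boolP (x \in A).
  rewrite (fintype.subsetP AS) //.
  have := toes_maps_in gA xA; rewrite !inE => /andP[-> /=]; exact: (fintype.subsetP AS).
case: ifPn => xS.
  have := @toes_maps_in _ _ x hSA; rewrite !inE xA xS => /(_ isT).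
  by move=> /and3P[-> _ ->].
by rewrite (toes_maps_out hSA) // !inE (negbTE xS) andbF.
Qed.

Lemma glue_components (Ag : A \in components g) : A \in components (glue A g h).
Proof.
have [x xA] := components_neq0 Ag.
rewrite -{1}(componentsP Ag xA).
by have := glue_component x; rewrite xA => <-; exact: component_components.
Qed.

(** Outside [A] the components are those of [h]. The points of [A] are singleton components of [h],
    which [1 < j] keeps out of the count. *)
Lemma num_components_glue (j : nat) : A \in components g -> 1 < j ->
  num_components (glue A g h) j = (#|A| == j) + num_components h j.
Proof.
move=> Ag j1; rewrite /num_components.
rewrite (cardsD1 A) inE glue_components //=; congr (_ + _).
apply: eq_card => D; rewrite !inE.
apply/and3P/andP => [[DA Df Dj]|[Dh Dj]]; split => //.
- have [x xD] := components_neq0 Df.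
  have := glue_component x; rewrite (componentsP Df xD); case: ifPn => [xA|xA].
    by rewrite (componentsP Ag xA) => e; rewrite e eqxx in DA.
  by move=> ->; exact: component_components.
- have [x xD] := components_neq0 Dh.
  apply: contraTneq Dj => e; rewrite -(componentsP Dh xD).
  rewrite (toes_maps_component_out hSA) ?cards1 ?ltn_eqF //.
  by rewrite !inE -e xD.
have [x xD] := components_neq0 Dh.
have xA : x \notin A.
  apply: contraTN Dj => xA; rewrite -(componentsP Dh xD).
  by rewrite (toes_maps_component_out hSA) ?cards1 ?ltn_eqF // !inE xA.
by have := glue_component x; rewrite (negbTE xA) (componentsP Dh xD) => <-; exact: component_components.
Qed.

End Glue.

Lemma restrict_toes_maps S A f : A \subset S -> f \in toes_maps S ->
  A \in components f -> glue A f id_ffun \in connected_toes_maps A.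
Proof.
move=> AS fS Af; rewrite inE.
have gA : glue A f id_ffun \in toes_maps A.
  apply/toes_mapsP => x; rewrite !ffunE; have [xA|xA] := boolP (x \in A); last by [].
  have := toes_maps_in fS (fintype.subsetP AS x xA); rewrite !inE => /andP[-> _] /=.
  by rewrite (components_stable _ Af).
rewrite gA /=; have [x xA] := components_neq0 Af.
rewrite -{1}(componentsP Af xA) (@component_local _ (glue A f id_ffun) A) //.
- exact: component_components.
- by move=> y; rewrite (components_stable _ Af).
- by move=> y; rewrite (toes_maps_stable _ gA).
by move=> y yA; rewrite ffunE yA.
Qed.

Lemma remove_toes_maps S A f : f \in toes_maps S ->
  A \in components f -> glue A id_ffun f \in toes_maps (S :\: A)%SET.
Proof.
move=> fS Af; apply/toes_mapsP => x; rewrite !ffunE !inE.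
have [xA|xA] /= := boolP (x \in A); first by [].
rewrite (components_stable _ Af) xA /=.
by have := toes_mapsP _ _ fS x; case: ifP => //; rewrite !inE.
Qed.

(** Gluing is a bijection from the pairs of maps onto the maps with component [A], inverted by the
    two cuts. *)
Lemma sum_toes_maps_component (R : nmodType) S A (F : {ffun V -> V} -> R) :
  A \subset S ->
  (\sum_(f in toes_maps S | A \in components f) F f =
   \sum_(g in connected_toes_maps A) \sum_(h in toes_maps (S :\: A)%SET)
     F (glue A g h))%R.
Proof.
move=> AS; rewrite pair_big /=.
rewrite (reindex_onto (fun p : {ffun V -> V} * {ffun V -> V} => glue A p.1 p.2)
   (fun f => (glue A f id_ffun, glue A id_ffun f))) /=; last first.
  by move=> f _; apply/ffunP => x; rewrite !ffunE; case: (x \in A).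
apply: eq_bigl => -[g h] /=; apply/andP/andP => [[/andP[fS Af]] /eqP[eg eh]|[]].
  by rewrite -eg -{2}eh (restrict_toes_maps AS fS Af) (remove_toes_maps fS Af).
rewrite inE => /andP[gA Ag] hSA; rewrite (glue_toes_maps AS gA hSA) (glue_components gA hSA) //.
split => //; apply/eqP; congr (_, _); apply/ffunP => x; rewrite !ffunE; have [xA|xA] := boolP (x \in A) => //.
  by rewrite (toes_maps_out gA).
by rewrite (toes_maps_out hSA) // !inE xA.
Qed.

(** * Counting the connected maps *)

Lemma toes_maps_component_subset S f x :
  f \in toes_maps S -> x \in S -> component f x \subset S.
Proof.
move=> fS xS; apply/fintype.subsetP => y /component_eq e; apply: contraLR xS => yS.
have := component_refl f x; rewrite -e (toes_maps_component_out fS yS) inE.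
by move=> /eqP ->.
Qed.

(** Removing [x0] leaves an arbitrary subset of size [p] among [#|S|.-1] points. *)
Lemma sum_subset_card S x0 (G : nat -> nat) : x0 \in S ->
  \sum_(A : {set V} | (A \subset S) && (x0 \in A)) G #|A| =
  \sum_(p < #|S|.-1.+1) 'C(#|S|.-1, p) * G p.+1.
Proof.
move=> x0S; set M := #|S|.-1.
have cM : #|(S :\ x0)%SET| = M by rewrite /M (cardsD1 x0 S) x0S.
transitivity (\sum_(B : {set V} | B \subset (S :\ x0)%SET) G #|B|.+1).
  rewrite (reindex_onto (fun B : {set V} => (x0 |: B)%SET) (fun A => A :\ x0)%SET) /=; last first.
    by move=> A /andP[_ x0A]; rewrite finset.setD1K.
  apply: eq_big => [B|B /andP[_ /eqP e]]; last first.
    by rewrite cardsU1 -{1}e !inE eqxx.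
  rewrite finset.subsetD1 finset.subUset finset.sub1set x0S finset.setU11 andbT /=; congr andb.
  apply/eqP/idP => [e|x0B]; first by rewrite -e !inE eqxx.
  by rewrite finset.setU1K.
rewrite (partition_big (fun B : {set V} => inord #|B| : 'I_M.+1) xpredT) //=.
apply: eq_bigr => p _.
rewrite -[X in 'C(X, _)]cM -cards_draws -sum_nat_const.
apply: eq_big => [B|B /andP[BS /eqP <-]]; rewrite ?inE.
  have [BS|//] := boolP (B \subset _); rewrite /= -val_eqE /= inordK //.
  by rewrite ltnS -cM subset_leq_card.
by rewrite inordK // ltnS -cM subset_leq_card.
Qed.

(** The maps are classified by the component [A] of [x0]; cutting it out leaves a connected map of
    [A] and any map of [S :\: A]. *)
Lemma card_toes_maps_rec S x0 : x0 \in S ->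
  \sum_(A : {set V} | (A \subset S) && (x0 \in A))
     #|connected_toes_maps A| * (#|S| - #|A|).-1 ^ (#|S| - #|A|) =
  #|S|.-1 ^ #|S|.
Proof.
move=> x0S; rewrite -[RHS]card_toes_maps -[RHS]sum1_card.
rewrite [RHS](partition_big (fun f : {ffun V -> V} => component f x0)
   (fun A : {set V} => (A \subset S) && (x0 \in A))) /=; last first.
  by move=> f fS; rewrite component_refl toes_maps_component_subset.
apply: eq_bigr => A /andP[AS x0A].
transitivity (\sum_(f in toes_maps S | A \in components f) 1); last first.
  apply: eq_bigl => f; congr andb; apply/idP/eqP => [Af|<-].
    exact: componentsP.
  exact: component_components.
rewrite (@sum_toes_maps_component nat) // sum_nat_const.
by rewrite sum1_card card_toes_maps cardsDS.
Qed.

(** Strong induction on the size of [S]: both sides satisfy the same recursion, and its top term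
    determines them. *)
Lemma card_connected_toes_maps S :
  0 < #|S| -> #|connected_toes_maps S| = connected_count #|S|.
Proof.
have [n] := ubnP #|S|; elim: n S => // n IH S Sn S0.
have [x0 x0S] : exists x0, x0 \in S by apply/finset.set0Pn; rewrite -card_gt0.
have := card_toes_maps_rec x0S.
have := @sum_subset_card S x0
  (fun a => connected_count a * (#|S| - a).-1 ^ (#|S| - a)) x0S.
under [in RHS]eq_bigr => p _ do rewrite mulnA.
have -> : \sum_(p < #|S|.-1.+1) 'C(#|S|.-1, p) * connected_count p.+1 *
    (#|S| - p.+1).-1 ^ (#|S| - p.+1) = #|S|.-1 ^ #|S|.
  have [M ->] : exists M, #|S| = M.+1 by exists #|S|.-1; rewrite prednK.
  by rewrite -connected_count_rec; apply: eq_bigr => p _; rewrite subSS.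
move=> <-.
(* The term [A = S] has weight [0 ^ 0 = 1]; the others concern smaller sets and cancel by
   induction. *)
rewrite (bigD1 S) ?subxx //= [RHS](bigD1 S) ?subxx //= subnn !muln1.
rewrite [X in _ = _ + X](eq_bigr (fun A : {set V} => #|connected_toes_maps A| * (#|S| - #|A|).-1 ^ (#|S| - #|A|))).
  by move=> /addIn.
move=> A /andP[/andP[AS x0A] AnS]; rewrite IH //.
  have : A \proper S by rewrite finset.properEneq AnS.
  by move/proper_card => h; exact: leq_trans h _.
by apply/card_gt0P; exists x0.
Qed.

(** * Counting maps with ordered choices of components *)

(** Choosing a first component of size [j] leaves one fewer of that size for the later choices:
    [C j ^_ r.+1 = C j * (C j).-1 ^_ r]. *)
Lemma prod_ffact_count_cons (C : nat -> nat) (b j : nat) (s : seq nat) :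
  2 <= j <= b ->
  \prod_(2 <= k < b.+1) C k ^_ count_mem k (j :: s) =
  C j * \prod_(2 <= k < b.+1) (C k - (j == k)) ^_ count_mem k s.
Proof.
move=> jb; have jI : j \in index_iota 2 b.+1 by rewrite mem_index_iota ltnS.
rewrite !(bigD1_seq j) ?iota_uniq //= eqxx add1n ffactnS subn1 -mulnA.
congr (_ * (_ * _)); apply: eq_bigr => k kj.
by rewrite eq_sym (negbTE kj) subn0.
Qed.

(** Here [s] lists the sizes of the components chosen in order, and the factorials on the left keep
    the identity in [nat]. The induction cuts out the first chosen component and treats the others
    inside its complement. *)
Lemma sum_toes_maps_prod_ffact (b : nat) (s : seq nat) S :
  all (fun j => 2 <= j <= b) s -> sumn s <= #|S| ->
  (\sum_(f in toes_maps S)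
     \prod_(2 <= k < b.+1) num_components f k ^_ count_mem k s) *
    \prod_(j <- s) j`! =
  \prod_(j <- s) connected_count j * #|S| ^_ sumn s *
    (#|S| - sumn s).-1 ^ (#|S| - sumn s).
Proof.
elim: s S => [|j s IH] S /=.
  move=> _ _; rewrite !big_nil ffactn0 subn0 !muln1 mul1n -[RHS]card_toes_maps -[RHS]sum1_card.
  by apply: eq_bigr => f _; rewrite big1.
move=> /andP[jb sb] le.
have [j2 jb'] := andP jb.
(* The factor [num_components f j] is opened as a sum over the first chosen component [A]. *)
rewrite (eq_bigr (fun f => \sum_(A in components f | #|A| == j)
    \prod_(2 <= k < b.+1) (num_components f k - (j == k)) ^_ count_mem k s)); last first.
  move=> f _; rewrite (@prod_ffact_count_cons (num_components f)) // sum_nat_cond_const.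
  by congr (_ * _); apply: eq_card => A; rewrite !inE.
rewrite (exchange_big_dep (fun A : {set V} => (A \subset S) && (#|A| == j))) /=; last first.
  move=> f A fS /andP[Af /eqP Aj]; rewrite Aj eqxx andbT.
  by apply: toes_maps_component_sub fS Af _; rewrite Aj.
(* The contribution of one [A], times the factorials of the remaining sizes; it depends on [A] only
   through [#|A| = j]. *)
pose W := connected_count j * \prod_(i <- s) connected_count i *
   (#|S| - j) ^_ sumn s * (#|S| - j - sumn s).-1 ^ (#|S| - j - sumn s).
rewrite big_cons mulnCA big_distrl /=.
rewrite (eq_bigr (fun _ => W)); last first.
  move=> A /andP[AS /eqP Aj].
  have cSA : #|(S :\: A)%SET| = #|S| - j by rewrite cardsDS // Aj.
  rewrite (eq_bigl (fun f => (f \in toes_maps S) && (A \in components f))); last first.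
    by move=> f; rewrite Aj eqxx andbT.
  rewrite (@sum_toes_maps_component nat) //.
  rewrite [X in X * _](eq_bigr (fun _ => \sum_(h in toes_maps (S :\: A)%SET)
     \prod_(2 <= k < b.+1) num_components h k ^_ count_mem k s)); last first.
    move=> g; rewrite inE => /andP[gA Ag]; apply: eq_bigr => h hSA.
    rewrite big_nat_cond [RHS]big_nat_cond; apply: eq_bigr => k /andP[/andP[k2 _] _].
    (* The glued map has [j == k] more components of size [k] than [h], exactly the amount
       subtracted. *)
    by rewrite (num_components_glue gA hSA) // Aj addKn.
  rewrite sum_nat_const card_connected_toes_maps ?Aj; last exact: ltnW.
  rewrite -mulnA IH //; last by rewrite cSA leq_subRL //; apply: leq_trans le; exact: leq_addr.
  by rewrite cSA /W !mulnA.
rewrite sum_nat_cond_const.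
have -> : #|[set A : {set V} | (A \subset S) && (#|A| == j)]%SET| = 'C(#|S|, j).
  exact: cards_draws.
(* The number of sets [A] times j! is [#|S| ^_ j], which extends the falling factorial in [W]. *)
rewrite /W ffactD -(bin_ffact _ j) subnDA big_cons; ring.
Qed.

End Maps.

Local Open Scope ring_scope.
Local Open Scope classical_set_scope.

(** * The law of the random mapping *)

(** The integrand is a combination of the indicators of the fibres of [X], integrated term by term
    since the coefficients are nonnegative. *)
Lemma expectation_finType (R : realType) (d : measure_display)
    (T : measurableType d) (P : probability T R) (V : finType) (X : T -> V)
    (g : V -> R) :
  (forall v, measurable (X @^-1` [set v])) -> (forall v, 0 <= g v) ->
  ('E_P[fun t => g (X t)] = \sum_v (g v)%:E * P (X @^-1` [set v]))%E.
Proof.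
move=> mX g0; rewrite unlock.
transitivity (\int[P]_t (\sum_v (g v)%:E * (\1_(X @^-1` [set v]) t)%:E))%E.
  apply: eq_integral => t _.
  rewrite (bigD1 (X t)) //= indicE mem_set // mule1 big1 ?adde0 // => v vX.
  by rewrite indicE memNset ?mule0 //= => e; rewrite e eqxx in vX.
rewrite ge0_integral_sum //=.
- apply: eq_bigr => v _; rewrite ge0_integralZl_EFin //=.
  + by rewrite integral_indic // setIT.
  + by exact/measurable_EFinP/measurable_indic.
- by move=> v; apply: measurable_funeM; exact/measurable_EFinP/measurable_indic.
- by move=> v t _; rewrite mule_ge0 ?lee_fin.
Qed.

Section Law.
Context {R : realType} {d : measure_display} {T : measurableType d}.
Variables (P : probability T R) (n : nat) (B : 'I_n -> T -> 'I_n).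
Hypotheses (n2 : (2 <= n)%N) (toesB : screaming_toes P B).

Lemma screaming_toes_fixed i : P (B i @^-1` [set i]) = 0%E.
Proof.
have mB j : measurable (B i @^-1` [set j]) by exact: (toes_measurable toesB).
(* The expectation of the constant 1 is the total mass of the fibres, which the [n - 1] fibres over
   [j != i] already use up. *)
have := @expectation_finType R d T P _ (B i) (fun=> 1) mB (fun=> ler01).
rewrite (_ : (fun=> 1) = cst 1) // expectation_cst.
under eq_bigr do rewrite mul1e.
rewrite (bigD1 i) //= (eq_bigr (fun=> ((n%:R - 1)^-1)%:E)); last first.
  by move=> j ji; exact: (toes_law toesB).
rewrite sumEFin sumr_const cardC1 card_ord.
have -> : n%:R - 1 = n.-1%:R :> R by rewrite -subn1 natrB // ltnW.
rewrite -[X in (_ + X%:E)%E]mulr_natr mulVf ?pnatr_eq0; last by case: n n2 => [|[]].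
have /fineK <- : P (B i @^-1` [set i]) \is a fin_num by exact: fin_num_measure.
by move=> /eqP; rewrite -EFinD eqe -subr_eq0 opprD addrCA subrr addr0 oppr_eq0 => /eqP ->.
Qed.

Definition toes_mapping t : {ffun 'I_n -> 'I_n} := [ffun i => B i t].

Lemma toes_mapping_preimage (f : {ffun 'I_n -> 'I_n}) :
  toes_mapping @^-1` [set f] =
  \bigcap_(i in [set` [set: 'I_n]%SET]) (B i @^-1` [set f i]).
Proof.
apply/seteqP; split => [t <- i _|t /= h]; first by rewrite /= ffunE.
by apply/ffunP => i; rewrite ffunE; apply: h; rewrite /= inE.
Qed.

Lemma measurable_toes_mapping f : measurable (toes_mapping @^-1` [set f]).
Proof.
rewrite toes_mapping_preimage; apply: fin_bigcap_measurable => // i _.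
exact: (toes_measurable toesB).
Qed.

(** Independence over all indices gives [n] equal factors, or a zero factor at a fixed point of
    [f]. *)
Lemma toes_mapping_law f :
  P (toes_mapping @^-1` [set f]) =
  (if f \in toes_maps [set: 'I_n]%SET then (n%:R - 1) ^- n else 0)%:E.
Proof.
rewrite toes_mapping_preimage (toes_independent toesB _ (fun i => [set f i])).
case: ifPn => [fS|fS].
  rewrite (eq_bigr (fun=> ((n%:R - 1)^-1)%:E)); last first.
    move=> i _; apply: (toes_law toesB).
    by have := @toes_maps_in _ _ _ i fS; rewrite !inE andbT; apply.
  by rewrite prodEFin prodr_const cardsT card_ord exprVn.
have [i fi] : exists i, f i = i.
  apply: contrapT => nf; move/negP: fS; apply; apply/toes_mapsP => x.
  by rewrite !inE andbT; apply/eqP => fx; apply: nf; exists x.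
by rewrite (bigD1 i) ?inE //= fi screaming_toes_fixed mul0e.
Qed.

Lemma expectation_screaming_toes (g : {ffun 'I_n -> 'I_n} -> nat) :
  'E_P[fun t => (g (toes_mapping t))%:R]%E =
  ((\sum_(f in toes_maps [set: 'I_n]%SET) g f)%:R / (n%:R - 1) ^+ n)%:E.
Proof.
rewrite (@expectation_finType _ _ _ _ _ toes_mapping (fun f => (g f)%:R)) //; last first.
  exact: measurable_toes_mapping.
rewrite (eq_bigr (fun f => ((g f)%:R * (if f \in toes_maps [set: 'I_n]%SET then (n%:R - 1) ^- n else 0))%:E)); last first.
  by move=> f _; rewrite toes_mapping_law EFinM.
rewrite sumEFin natr_sum mulr_suml [in RHS]big_mkcond /=; congr EFin.
by apply: eq_bigr => f _; case: ifP; rewrite ?mulr0.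
Qed.

End Law.

(** * The Poisson form of the connected counts *)

(** The factor [expR j%:R] cancels the exponential in the Poisson weights. *)
Lemma toes_lambda_expR (R : realType) (j : nat) : (2 <= j)%N ->
  toes_lambda R j * expR j%:R = (connected_count j)%:R / j`!%:R.
Proof.
move=> j2; have j0 : (0 < j)%N by exact: ltnW.
rewrite /toes_lambda.
have -> : poisson_prob (j%:R : R) 0 [set k | (k < j.-1)%N] =
    (\sum_(k < j.-1) poisson_pmf (j%:R : R) k)%:E.
  rewrite /poisson_prob ltr0n j0 esum_fset; last by move=> k _; rewrite lee_fin poisson_pmf_ge0.
    by rewrite -sumEFin (fsbig_ord _ _ (fun k => (poisson_pmf (j%:R : R) k)%:E)); apply: eq_fsbigl.
  exact: finite_II.
(* Reversal sets [t = j - k.+1], so [j.-1 - t = k] and [j.-1 ^_ t] is (j-1)! / k!. *)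
rewrite /connected_count natr_sum big_rev_mkord subn1.
rewrite [fine _]/= mulr_sumr !mulr_suml; apply: eq_bigr => k _.
have tj : (j.-1 - (j - k.+1))%N = k by have := ltn_ord k; lia.
rewrite tj /poisson_pmf ltr0n j0.
have e : (j.-1 ^_ (j - k.+1))%:R = j.-1`!%:R / k`!%:R :> R.
  rewrite -[in RHS](@ffact_fact j.-1 (j - k.+1)); last by have := ltn_ord k; lia.
  by rewrite tj natrM mulfK // pnatr_eq0 -lt0n fact_gt0.
have ej : j`!%:R = j%:R * j.-1`!%:R :> R by rewrite -{1}(prednK j0) factS prednK // natrM.
have nz i : i`!%:R != 0 :> R by rewrite pnatr_eq0 -lt0n fact_gt0.
have jz : j%:R != 0 :> R by rewrite pnatr_eq0 -lt0n.
rewrite natrM natrX e ej expRN.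
have := lt0r_neq0 (expR_gt0 (j%:R : R)).
move: (nz k) (nz j.-1) => kz jz' ez; field; rewrite ?kz ?jz' ?ez ?jz //.
Qed.

(** * From exponents to a list of sizes, and the moment formula *)

Section Expand.
Variables (b : nat) (r : nat -> nat).

(** The form of the exponents that the induction on chosen components consumes, one size at a
    time. *)
Definition size_list : seq nat :=
  flatten [seq nseq (r j) j | j <- index_iota 2 b.+1].

Lemma count_size_list k : (2 <= k < b.+1)%N -> count_mem k size_list = r k.
Proof.
move=> kb; rewrite /size_list count_flatten -map_comp sumnE big_map.
rewrite (bigD1_seq k) ?iota_uniq ?mem_index_iota //= count_nseq /= eqxx mul1n.
rewrite big1 ?addn0 // => j jk; by rewrite count_nseq /= (negbTE jk).
Qed.

Lemma sumn_size_list : sumn size_list = (\sum_(2 <= j < b.+1) j * r j)%N.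
Proof.
rewrite /size_list sumn_flatten -map_comp sumnE big_map.
by apply: eq_bigr => j _; rewrite /= sumn_nseq.
Qed.

Lemma prod_size_list (K : comPzSemiRingType) (F : nat -> K) :
  \prod_(j <- size_list) F j = \prod_(2 <= j < b.+1) F j ^+ r j.
Proof.
rewrite /size_list big_flatten big_map; apply: eq_bigr => j _.
by rewrite big_nseq iter_mulr_1.
Qed.

Lemma all_size_list : all (fun j => 2 <= j <= b)%N size_list.
Proof.
apply/allP => k /flattenP[s /mapP[j]]; rewrite mem_index_iota ltnS => jb ->.
by rewrite mem_nseq => /andP[_ /eqP ->].
Qed.

End Expand.

Theorem mainTheorem2 (R : realType) (d : measure_display)
    (T : measurableType d) (P : probability T R)
    (n : nat) (B : 'I_n -> T -> 'I_n) (b : nat) (r : nat -> nat) (m : nat) :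
  (2 <= n)%N -> screaming_toes P B ->
  (2 <= b <= n)%N ->
  m = (\sum_(2 <= j < b.+1) j * r j)%N -> (m <= n)%N ->
  'E_P[fun t => (\prod_(2 <= j < b.+1)
                  (num_components (fun i => B i t) j ^_ r j)%:R)%R]%E =
  ((\prod_(2 <= j < b.+1) toes_lambda R j ^+ r j) *
   expR m%:R * (n ^_ m)%:R *
   ((n%:R - m%:R - 1) ^+ (n - m) / (n%:R - 1) ^+ n))%:E.
Proof.
move=> n2 toesB _ mE mn.
pose s := size_list b r.
have sm : sumn s = m by rewrite sumn_size_list -mE.
pose g (f : {ffun 'I_n -> 'I_n}) :=
  (\prod_(2 <= k < b.+1) num_components f k ^_ count_mem k s)%N.
rewrite (_ : (fun t => _) = (fun t => (g (toes_mapping B t))%:R)); last first.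
  apply/funext => t; rewrite /g natr_prod.
  rewrite (_ : (fun i => B i t) = toes_mapping B t :> (_ -> _)); last first.
    by apply/funext => i; rewrite ffunE.
  rewrite big_nat_cond [RHS]big_nat_cond; apply: eq_bigr => k /andP[kb _].
  by rewrite count_size_list.
rewrite (expectation_screaming_toes n2 toesB); congr EFin; rewrite mulrA; congr (_ / _).
have := @sum_toes_maps_prod_ffact 'I_n b s [set: 'I_n]%SET (all_size_list b r).
rewrite cardsT card_ord sm => /(_ mn) /(congr1 (fun k => k%:R : R)).
rewrite !natrM !natr_prod => e.
have fz : \prod_(j <- s) j`!%:R != 0 :> R.
  by rewrite prodf_seq_neq0; apply/allP => j _; rewrite /= pnatr_eq0 -lt0n fact_gt0.
(* Multiplying by the factorials of the chosen sizes brings the left side to the form of the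
   counting identity. *)
apply: (mulIf fz); rewrite [LHS]e.
(* At [m = n] the two bases differ, but both powers have exponent 0. *)
have -> : ((n - m).-1 ^ (n - m))%:R = (n%:R - m%:R - 1) ^+ (n - m) :> R.
  rewrite -natrB //; case: (n - m)%N => [|q]; first by [].
  by rewrite natrX -natr1 addrK.
(* Each chosen component of size [j] receives a factor [expR j%:R], to be paired with its
   [toes_lambda R j]. *)
have -> : expR m%:R = \prod_(2 <= j < b.+1) expR (j%:R : R) ^+ r j.
  rewrite mE natr_sum expR_sum; apply: eq_bigr => j _.
  by rewrite natrM expRM_natr.
rewrite -big_split /=.
under [X in _ = X * _ * _ * _]eq_bigr do rewrite -exprMn.
rewrite -(prod_size_list b r (fun j => toes_lambda R j * expR j%:R)).
have -> : \prod_(j <- s) (connected_count j)%:R =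
  (\prod_(j <- s) (toes_lambda R j * expR j%:R)) * \prod_(j <- s) j`!%:R.
  rewrite -big_split /= big_seq [RHS]big_seq; apply: eq_bigr => j js.
  have /andP[j2 _] := allP (all_size_list b r) j js.
  by rewrite toes_lambda_expR // divfK // pnatr_eq0 -lt0n fact_gt0.
rewrite /s; ring.
Qed.
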